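(* For every fixed integer $k\ge 3$, as $x\to\infty$, $$\sum_{n\le x} c_k(n)= \frac{\zeta(k)}{k}H(k)x^k + O\left(x^{k-1} \log x \right),$$ where $$H(k)= \prod_p \left(1+\frac1{p^2}+\frac1{p^3}+\cdots +\frac1{p^k}\right),$$ the product being over all primes $p$.
   Context: For positive integers $k,n$, $c_k(n)$ denotes the number of cyclic subgroups of the additive group $\mathbb{Z}_n^k=\mathbb{Z}_n\times\cdots\times\mathbb{Z}_n$ ($k$ factors), where $\mathbb{Z}_n$ is the cyclic group of residue classes modulo $n$. $\zeta$ is the Riemann zeta function. The sum is over positive integers $n\le x$. The implied constant in the $O$-term may depend on the fixed integer $k$. *)

(* Defs.v *)
From HB Require Import structures.
From mathcomp Require Import all_boot all_order all_algebra all_fingroup all_solvable.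
From mathcomp Require Import all_classical all_reals all_analysis.
Import Order.TTheory GRing.Theory Num.Theory numFieldNormedType.Exports.
Set Implicit Arguments.
Unset Strict Implicit.
Unset Printing Implicit Defensive.
Local Open Scope ring_scope.

(* The additive group (Z/nZ)^k for n > 0.  The index type is 'I_n.-1.+1, which
   has n elements and addition modulo n for every n > 0; 'Z_n would denote Z/2
   for n = 1. *)
Notation Zmod_pow n k := 'rV['I_n.-1.+1]_k.

(* The group law underlying {group 'rV_k} is addition of row vectors. *)
Definition cyclic_subgroup_count (k n : nat) : nat :=
  #|[set C : {group Zmod_pow n k} | cyclic C]|.

(* Dirichlet series of zeta, so the Riemann zeta function only for s > 1;
   riemannR s n is 1 / (n + 1) `^ s. *)
Definition riemann_zeta (R : realType) (s : R) : R :=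
  limn (series (riemannR s)).

Definition H_product (R : realType) (k : nat) : R :=
  limn (fun N : nat =>
    \prod_(0 <= p < N | prime p)
       (1 + \sum_(2 <= j < k.+1) (p%:R : R) ^- j)).

(* The Landau notations need a canonical filter structure on +oo. *)
Canonical pinfty_filter_on (R : numFieldType) : filter_on R :=
  FilterType (pinfty_nbhs R) (@filter_filter R _ proper_pinfty_nbhs).

(* Main.v *)
(* Grouping the elements of (Z/n)^k by order, and counting those of exact order
   d by inclusion-exclusion over the primes dividing d, gives
     c_k(n) = \sum_(d | n) d^(k-1) \prod_(p | d) (1 + w p),
   with w p = p^-1 + ... + p^-(k-1).  Expanding the product over sets J of
   primes, with t the product of J, turns the summatory function into
     \sum_J w(J) \sum_e t^(k-1) \sum_(m <= x / (t e)) m^(k-1).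
   The inner sum is z^k / k at z = x / (t e), up to 2^k z^k / (1 + z), a bound
   valid for z < 1 as well.  Hence the sums over J and e can be extended beyond
   x, where they give H(k) and zeta(k), and the total error is at most a constant
   times x^(k-1) \sum_J w(J) x / (x + t).  Writing w p = p^-1 + O(p^-2) bounds
   the last sum by a convergent product times
   \sum_m m^-1 x / (x + m) <= 1 + ln (1 + x). *)

Require Import Defs.
From HB Require Import structures.
From mathcomp Require Import all_boot all_order all_algebra all_fingroup all_solvable.
From mathcomp Require Import all_classical all_reals all_analysis.
From mathcomp Require Import ring lra.
Import Order.TTheory GRing.Theory Num.Theory numFieldNormedType.Exports.
Local Open Scope ring_scope.
Set Implicit Arguments.
Unset Strict Implicit.
Unset Printing Implicit Defensive.

(** * Squarefree numbers as sets of primes *)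

Lemma prod_add_subsets (R : comNzRingType) (I : finType) (D : {set I})
    (F G : I -> R) :
  \prod_(i in D) (F i + G i) =
  \sum_(J : {set I} | J \subset D)
     (\prod_(i in J) F i) * \prod_(i in D :\: J) G i.
Proof.
rewrite big_mkcond /=.
(* Outside [D] the factor is written 0 + 1, so that in the expansion over all subsets those not
   contained in [D] vanish. *)
transitivity (\prod_i ((if i \in D then F i else 0) +
                       (if i \in D then G i else 1))).
  by apply: eq_bigr => i _; case: ifP => // _; rewrite add0r.
rewrite bigA_distr [RHS]big_mkcond /=; apply: eq_bigr => J _.
case: ifPn => [JD|/subsetPn[i iJ iD]]; last first.
  by rewrite (bigD1 i) //= iJ (negbTE iD) mul0r.
rewrite [X in _ = X * _]big_mkcond [X in _ = _ * X]big_mkcond -big_split /=.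
apply: eq_bigr => i _; rewrite finset.in_setD.
case: (boolP (i \in J)) => iJ /=; first by rewrite (fintype.subsetP JD _ iJ) mulr1.
by rewrite mul1r.
Qed.

Local Notation prime_set N := [set p : 'I_N | prime (val p)].

Definition prime_divs (N d : nat) : {set 'I_N} :=
  [set p : 'I_N | val p \in primes d].

(** For [J] inside [prime_set N] this is a squarefree number whose set of prime factors is [J]; sums
    over such [J] stand for sums over squarefree numbers. *)
Definition prodset (N : nat) (J : {set 'I_N}) : nat := (\prod_(p in J) val p)%N.

Lemma prod_primesE (R : comNzRingType) (N d : nat) (F : nat -> R) :
  (0 < d < N)%N ->
  \prod_(p <- primes d) F p = \prod_(p in prime_divs N d) F (val p).
Proof.
move=> /andP[d0 dN].
transitivity (\prod_(0 <= p < N | p \in primes d) F p); last first.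
  by rewrite big_mkord; apply: eq_bigl => p; rewrite inE.
rewrite -[RHS]big_filter; apply: perm_big; apply: uniq_perm.
- exact: primes_uniq.
- by rewrite filter_uniq // iota_uniq.
move=> p; rewrite mem_filter mem_index_iota /=.
case: (boolP (p \in primes d)) => //; rewrite mem_primes => /and3P[_ _ pd].
by rewrite (leq_ltn_trans (dvdn_leq d0 pd) dN).
Qed.

Lemma prime_dvd_prodset (N : nat) (J : {set 'I_N}) (p : 'I_N) :
  (forall q, q \in J -> prime (val q)) -> prime (val p) ->
  (val p %| prodset J)%N = (p \in J).
Proof.
move=> Jp pp; rewrite /prodset; apply/idP/idP => [|pJ]; last first.
  by rewrite (bigD1 p) //= dvdn_mulr.
rewrite Euclid_dvd_prod // big_has_cond => /hasP[q _ /andP[qJ]].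
by rewrite dvdn_prime2 // ?Jp // => /eqP /val_inj ->.
Qed.

(** Distinct primes are coprime, so the primes of [J] can be split off one at a time by Gauss's
    lemma. *)
Lemma prodset_dvd (N : nat) (J : {set 'I_N}) (m : nat) :
  (forall q, q \in J -> prime (val q)) ->
  (prodset J %| m)%N = [forall q in J, val q %| m]%N.
Proof.
move=> Jp; apply/idP/forall_inP => [tm q qJ|].
  by apply: dvdn_trans tm; rewrite /prodset (bigD1 q) //= dvdn_mulr.
rewrite /prodset -big_enum /= => Jm.
have {}Jm : forall q, q \in enum J -> prime (val q) && (val q %| m)%N.
  by move=> q; rewrite mem_enum => qJ; rewrite Jp // Jm.
elim: (enum J) (enum_uniq J) Jm => [|p s IHs] /= => [|/andP[ps us]] Jm.
  by rewrite big_nil dvd1n.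
rewrite big_cons Gauss_dvd; last first.
  have /andP[pp _] := Jm p (mem_head _ _).
  rewrite prime_coprime // Euclid_dvd_prod // big_has; apply/hasPn => q qs.
  have := Jm q; rewrite in_cons qs orbT => /(_ isT) /andP[qp _].
  by rewrite dvdn_prime2 //; apply: contra ps => /eqP /val_inj ->; exact: qs.
have /andP[_ ->] := Jm p (mem_head _ _).
by apply: IHs => // q qs; apply: Jm; rewrite in_cons qs orbT.
Qed.

Lemma prime_divs_prime (N d : nat) (q : 'I_N) : q \in prime_divs N d -> prime (val q).
Proof. by rewrite inE mem_primes => /and3P[]. Qed.

(** Separates the dependence on [d] into one divisibility condition, so that sums over [d] and over
    [J] can be exchanged. *)
Lemma subset_prime_divs (N d : nat) (J : {set 'I_N}) : (0 < d)%N ->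
  (J \subset prime_divs N d) =
  (J \subset prime_set N) && (prodset J %| d)%N.
Proof.
move=> d0; apply/idP/andP => [JD|[/fintype.subsetP JP]].
  split.
    by apply/fintype.subsetP => q /(fintype.subsetP JD)/prime_divs_prime; rewrite inE.
  rewrite prodset_dvd; last by move=> q /(fintype.subsetP JD) /prime_divs_prime.
  by apply/forall_inP => q /(fintype.subsetP JD); rewrite inE mem_primes => /and3P[].
rewrite prodset_dvd; last by move=> q /JP; rewrite inE.
move=> /forall_inP Jd; apply/fintype.subsetP => q qJ; rewrite inE mem_primes d0 Jd //.
by have := JP q qJ; rewrite inE => ->.
Qed.

(** * Elements of given order in (Z/n)^k *)

Lemma card_multiples (n m : nat) : (0 < m)%N ->
  #|[set i : 'I_(m * n) | m %| val i]%N| = n.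
Proof.
move=> m0.
have lt (j : 'I_n) : (m * j < m * n)%N by rewrite ltn_pmul2l.
rewrite -[RHS]card_ord -(card_imset predT (f := fun j : 'I_n => Ordinal (lt j))); last first.
  by move=> i j /(congr1 val) /= /eqP; rewrite eqn_pmul2l // => /eqP /val_inj.
apply: eq_card => i; rewrite finset.in_set.
apply/idP/imsetP => [/dvdnP[j ij]|[j _ ->]] /=; last exact: dvdn_mulr.
have jn : (j < n)%N by rewrite -(ltn_pmul2l m0) mulnC -ij ltn_ord.
by exists (Ordinal jn) => //; apply: val_inj; rewrite /= ij mulnC.
Qed.

(** Since [n.+1 = m * d], an element is killed by [d] exactly when its representative is a multiple
    of [m]. *)
Lemma card_torsion_ord (n m d : nat) : n.+1 = (m * d)%N ->
  #|[set a : 'I_n.+1 | a *+ d == 0]| = d.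
Proof.
move=> nE.
have [m0 d0] : (0 < m)%N /\ (0 < d)%N by apply/andP; rewrite -muln_gt0 -nE.
rewrite -[RHS](@card_multiples d m) // -nE.
apply: eq_card => i; rewrite !finset.in_set Zp_mulrn -val_eqE /=.
by rewrite -[_ == _]/(n.+1 %| i * d)%N [X in (X %| _)%N]nE dvdn_pmul2r.
Qed.

(** Being killed by [d] is a coordinatewise condition, and each coordinate has [d] choices. *)
Lemma card_torsion_Zmod_pow (n k d : nat) : (0 < n)%N -> (d %| n)%N ->
  #|[set v : Zmod_pow n k | v *+ d == 0]| = (d ^ k)%N.
Proof.
move=> n0 /dvdnP[m nE].
have m0 : (0 < m)%N by move: n0; rewrite nE muln_gt0 => /andP[].
have d0 : (0 < d)%N by move: n0; rewrite nE muln_gt0 => /andP[].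
pose A := [set a : 'I_n.-1.+1 | a *+ d == 0].
have cA : #|A| = d.
  by apply: (@card_torsion_ord _ m); rewrite ?prednK.
rewrite -[RHS]/(d ^ k)%N -{2}cA -[in RHS](card_ord k) -card_ffun_on.
rewrite -(card_imset _ (f := fun f : {ffun 'I_k -> 'I_n.-1.+1} => \row_j f j)); last first.
  by move=> f g /rowP fg; apply/ffunP => j; have := fg j; rewrite !mxE.
apply: eq_card => v; rewrite inE; apply/eqP/imsetP => [vd|[f /ffun_onP fA ->]].
  exists [ffun j => v 0 j]; last by apply/rowP => j; rewrite !mxE ffunE.
  apply/ffun_onP => j; rewrite ffunE inE; apply/eqP.
  by move/rowP: vd => /(_ j); rewrite !mxE mulmxnE.
apply/rowP => j; rewrite mulmxnE !mxE.
by have := fA j; rewrite inE => /eqP.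
Qed.

(** For [o] dividing [d], the condition o | d / q is the same as q | d / o; in this form the
    conditions for the primes of [J] merge into one for their product. *)
Lemma dvdn_div_prodset (N d o : nat) (J : {set 'I_N}) : (0 < d)%N ->
  J \subset prime_divs N d ->
  (o %| d)%N && [forall p in J, o %| d %/ val p]%N = (o %| d %/ prodset J)%N.
Proof.
move=> d0 JD; have := JD; rewrite subset_prime_divs // => /andP[_ td].
have Jp q : q \in J -> prime (val q).
  by move=> /(fintype.subsetP JD)/prime_divs_prime.
have dvd_div (q : nat) : (o %| d)%N -> (q %| d)%N -> (o %| d %/ q)%N = (q %| d %/ o)%N.
  by move=> od qd; rewrite !dvdn_divRL // mulnC.
case: (boolP (o %| d)%N) => [od|od] /=; last first.
  by apply/esym/negbTE; apply: contra od => /dvdn_trans; apply; exact: dvdn_div.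
rewrite dvd_div // prodset_dvd //; apply: eq_forallb => q.
case: (boolP (q \in J)) => //= /(fintype.subsetP JD).
by rewrite inE mem_primes => /and3P[_ _ qd]; rewrite dvd_div.
Qed.

(** If [o] is a proper divisor of [d], it divides d / p for any prime p dividing d / o, and that
    factor vanishes. If [o = d], every factor is 1. *)
Lemma order_indicator (R : comNzRingType) (N d o : nat) : (0 < d < N)%N ->
  (o == d)%:R = (o %| d)%:R *
    \prod_(p in prime_divs N d) (- (o %| d %/ val p)%:R + 1) :> R.
Proof.
move=> /andP[d0 dN]; case: (boolP (o %| d)%N) => od; last first.
  by rewrite mul0r (_ : o == d = false) //; apply: contraNF od => /eqP ->.
rewrite mul1r; have [->|nod] := eqVneq o d.
  rewrite big1 // => p; rewrite inE mem_primes => /and3P[pp _ pd].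
  suff -> : (d %| d %/ val p)%N = false by rewrite oppr0 add0r.
  apply: gtnNdvd; last by rewrite ltn_Pdiv ?prime_gt1.
  by rewrite divn_gt0 ?prime_gt0 // dvdn_leq.
have /dvdnP[q dE] := od.
have q1 : (1 < q)%N.
  by case: q dE nod => [|[|q]] // dE; [rewrite dE in d0|rewrite dE mul1n eqxx].
have pd : (pdiv q %| d)%N by rewrite dE dvdn_mulr ?pdiv_dvd.
have pN : (pdiv q < N)%N by rewrite (leq_ltn_trans _ dN) // dvdn_leq.
rewrite (bigD1 (Ordinal pN)) /= ?inE ?mem_primes ?pdiv_prime ?d0 //.
by rewrite dvdn_divRL // {1}dE mulnC dvdn_mul ?pdiv_dvd ?addNr ?mul0r.
Qed.

(** This is the Jordan totient of [d]. Expanding the indicator of order [d] over sets [J] of primes,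
    the term of [J] counts the elements killed by d / t with t = [prodset J], namely (d / t)^k, with
    sign (-1)^|J|; these terms recombine into the product. *)
Lemma card_order_Zmod_pow (R : numFieldType) (n k d N : nat) :
  (0 < n)%N -> (d %| n)%N -> (d < N)%N ->
  #|[set v : Zmod_pow n k | #[v]%g == d]|%:R =
  d%:R ^+ k * \prod_(p in prime_divs N d) (1 - (val p)%:R ^- k) :> R.
Proof.
move=> n0 dn dN; have d0 : (0 < d)%N by rewrite (dvdn_gt0 n0).
rewrite -sum1_card natr_sum big_mkcond /=.
transitivity (\sum_(v : Zmod_pow n k) \sum_(J : {set 'I_N} | J \subset prime_divs N d)
    (-1) ^+ #|J| * ((#[v]%g %| d %/ prodset J)%N)%:R : R).
  apply: eq_bigr => v _; rewrite finset.in_set.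
  rewrite (_ : (if _ then _ else _) = (#[v]%g == d)%:R); last by case: ifP.
  rewrite (@order_indicator _ N) ?d0 // prod_add_subsets mulr_sumr.
  apply: eq_bigr => J JD; rewrite -dvdn_div_prodset // prodrN.
  rewrite [X in _ * (_ * X) = _]big1 ?mulr1 //.
  rewrite mulrCA; congr (_ * _); rewrite -mulnb natrM; congr (_ * _).
  rewrite -big_andE /=.
  rewrite (big_morph (fun b : bool => b%:R : R) (id1 := 1) (op1 := *%R)) //.
  by move=> [] []; rewrite ?mulr1 ?mulr0.
rewrite exchange_big /=.
under [X in _ * X]eq_bigr do rewrite addrC.
rewrite prod_add_subsets mulr_sumr; apply: eq_bigr => J JD.
have := JD; rewrite subset_prime_divs // => /andP[_ td].
rewrite [X in _ * (_ * X)]big1 // mulr1 prodrN -mulr_sumr mulrCA; congr (_ * _).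
transitivity ((#|[set v : Zmod_pow n k | v *+ (d %/ prodset J) == 0]|)%:R : R).
  rewrite -sum1_card natr_sum [RHS]big_mkcond; apply: eq_bigr => v _.
  by rewrite finset.in_set order_dvdn FinRing.zmodXgE; case: ifP.
rewrite card_torsion_Zmod_pow //; last by rewrite (dvdn_trans _ dn) // dvdn_div.
rewrite natrX natf_div // expr_div_n; congr (_ * _).
by rewrite natr_prod prodfV prodrXl.
Qed.

(** * Cyclic subgroups as a divisor sum *)

(** For a prime p, one plus this weight is (1 - p^-k) / (1 - p^-1), the local factor of the Jordan
    totient divided by that of Euler's. *)
Definition local_weight (R : fieldType) (k p : nat) : R :=
  \sum_(1 <= j < k) p%:R ^- j.

Lemma totient_prod (R : numFieldType) (N d : nat) : (0 < d < N)%N ->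
  (totient d)%:R = d%:R * \prod_(p in prime_divs N d) (1 - (val p)%:R^-1) :> R.
Proof.
move=> dN; have /andP[d0 _] := dN.
rewrite -(prod_primesE (fun p => 1 - p%:R^-1)) //.
rewrite totientE // natr_prod [X in _ = X%:R * _](prod_prime_decomp d0) prime_decompE big_map /=.
rewrite natr_prod -big_split /= big_seq [RHS]big_seq.
apply: eq_bigr => p pd; have := pd; rewrite mem_primes => /and3P[pp _ _].
have lp : (0 < logn p d)%N by rewrite logn_gt0.
have p0 : p%:R != 0 :> R by rewrite pnatr_eq0 -lt0n prime_gt0.
rewrite -{2}(prednK lp) expnS natrM natrM mulrBr mulr1 [in p%:R * _]mulrC mulfK //.
rewrite -[p.-1]subn1 natrB ?prime_gt0 //.
by rewrite mulrBl mul1r mulrC.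
Qed.

(** When [d] divides n, the left side is the number of cyclic subgroups of order [d] in (Z/n)^k:
    elements of order [d] over generators per subgroup. The identity is a geometric sum in each
    factor. *)
Lemma jordan_totient_quotient (R : numFieldType) (k N d : nat) :
  (0 < k)%N -> (0 < d < N)%N ->
  (d%:R ^+ k * \prod_(p in prime_divs N d) (1 - (val p)%:R ^- k)) / (totient d)%:R =
  d%:R ^+ k.-1 * \prod_(p in prime_divs N d) (1 + local_weight R k (val p)) :> R.
Proof.
move=> k0 dN; have /andP[d0 _] := dN.
have tn0 : (totient d)%:R != 0 :> R by rewrite pnatr_eq0 -lt0n totient_gt0.
apply: (mulIf tn0); rewrite divfK // (totient_prod R dN) mulrACA -exprSr prednK //.
congr (_ * _); rewrite -big_split; apply: eq_bigr => p _ /=.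
rewrite -exprVn.
have -> : 1 + local_weight R k (val p) = \sum_(j < k) (val p)%:R^-1 ^+ j.
  rewrite -(big_mkord xpredT (fun j => (val p)%:R^-1 ^+ j)) big_ltn // expr0.
  by congr (_ + _); apply: eq_bigr => j _; rewrite exprVn.
by rewrite -opprB subrX1 mulrC -mulrN opprB.
Qed.

(** A cyclic group of order m has totient(m) generators, so the weights of the generators of each
    cyclic subgroup add up to 1. *)
Lemma cyclic_subgroups_totient (R : numFieldType) (gT : finGroupType) :
  #|[set C : {group gT} | cyclic C]|%:R =
  \sum_(v : gT) (totient #[v]%g)%:R^-1 :> R.
Proof.
rewrite (partition_big (fun v : gT => <[v]>%G) (fun C : {group gT} => cyclic C)) /=; last first.
  by move=> v _; exact: cycle_cyclic.
rewrite -sum1_card natr_sum; under eq_bigl do rewrite finset.in_set.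
apply: eq_bigr => C /cyclicP[x Cx].
have ->: C = <[x]>%G by apply: val_inj.
transitivity (\sum_(v in [set v | generator <[x]>%g v]) (totient #[x]%g)%:R^-1 : R).
  rewrite sumr_const -totient_gen -[RHS]mulr_natr mulVf //.
  by rewrite pnatr_eq0 -lt0n totient_gt0 order_gt0.
apply: eq_big => v; rewrite finset.in_set.
  by rewrite /generator eq_sym -val_eqE.
by move=> /eqP xv; rewrite /order xv.
Qed.

Lemma cyclic_subgroup_countE (R : numFieldType) (k n N : nat) :
  (0 < k)%N -> (0 < n < N)%N ->
  (cyclic_subgroup_count k n)%:R =
  \sum_(1 <= d < N | (d %| n)%N)
     d%:R ^+ k.-1 * \prod_(p in prime_divs N d) (1 + local_weight R k (val p)) :> R.
Proof.
move=> k0 /andP[n0 nN]; rewrite /cyclic_subgroup_count cyclic_subgroups_totient.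
transitivity (\sum_(v : Zmod_pow n k) \sum_(1 <= d < N | (d %| n)%N)
   (#[v]%g == d)%:R * (totient d)%:R^-1 : R).
  apply: eq_bigr => v _.
  have vn : (#[v]%g %| n)%N.
    rewrite order_dvdn FinRing.zmodXgE; apply/eqP/rowP => j.
    rewrite mulmxnE mxE Zp_mulrn; apply: val_inj => /=.
    by rewrite [X in (_ %% X)%N](prednK n0) modnMl.
  (* Only [d] equal to the order of [v] contributes; it lies in the range because it divides
     [n < N]. *)
  rewrite big_mkcond (bigD1_seq #[v]%g) //= ?iota_uniq ?mem_index_iota ?order_gt0 //=; last first.
    by rewrite (leq_ltn_trans _ nN) // dvdn_leq.
  rewrite vn eqxx mul1r big1 ?addr0 // => d dv.
  by rewrite eq_sym (negbTE dv) mul0r if_same.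
rewrite exchange_big /= big_nat_cond [RHS]big_nat_cond; apply: eq_bigr => d.
move=> /andP[/andP[d0 dN] dn].
rewrite -jordan_totient_quotient ?d0 // -mulr_suml; congr (_ / _).
rewrite -(card_order_Zmod_pow _ _ n0 dn dN) -sum1_card natr_sum [RHS]big_mkcond.
by apply: eq_bigr => v _; rewrite finset.in_set; case: ifP.
Qed.

(** * Rearranging the summatory function *)

(** Substitution d = t m. The condition [t * m < B] already bounds m, so the range may end at any
    [A >= B], and one range serves every [t]. *)
Lemma sum_multiples (V : nmodType) (A B t : nat) (f : nat -> V) :
  (0 < t)%N -> (B <= A)%N ->
  \sum_(1 <= d < B | (t %| d)%N) f d =
  \sum_(1 <= m < A | (t * m < B)%N) f (t * m)%N.
Proof.
move=> t0 BA.
transitivity (\sum_(1 <= m < A) \sum_(1 <= d < B | d == (t * m)%N) f d).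
  rewrite (exchange_big_dep xpredT) //= big_mkcond; apply: eq_big_nat => d /andP[d0 dB].
  case: ifPn => [/dvdnP[m dE]|td]; last first.
    by rewrite big_pred0 // => m; apply: contraNF td => /eqP ->; rewrite dvdn_mulr.
  have m0 : (0 < m)%N by move: d0; rewrite dE muln_gt0 => /andP[].
  rewrite big_mkcond (bigD1_seq m) ?iota_uniq ?mem_index_iota //=; last first.
    by rewrite m0 (leq_trans _ BA) // (leq_ltn_trans _ dB) // dE leq_pmulr.
  rewrite dE mulnC eqxx big1 ?addr0 // => i im; rewrite eqn_pmul2l //.
  by rewrite eq_sym (negbTE im).
rewrite [RHS]big_mkcond; apply: eq_big_nat => m /andP[m0 mA].
case: ifPn => tB; last first.
  rewrite big_nat_cond big_pred0 // => d.
  by apply: contraNF tB => /andP[/andP[_ dB] /eqP <-].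
rewrite big_mkcond (bigD1_seq (t * m)%N) ?iota_uniq ?mem_index_iota ?muln_gt0 ?t0 ?m0 //=.
by rewrite eqxx big1 ?addr0 // => d dtm; rewrite (negbTE dtm).
Qed.

(** Writing n = d e and then d = t m, the constraint n <= X becomes m <= X / (t e). *)
Lemma sum_divisor_multiples (V : nmodType) (X N E t : nat) (G : nat -> V) :
  (0 < t)%N -> (X < N)%N -> (X < E)%N ->
  \sum_(1 <= n < X.+1) \sum_(1 <= d < N | (d %| n)%N && (t %| d)%N) G d =
  \sum_(1 <= e < E) \sum_(1 <= m < (X %/ (t * e)).+1) G (t * m)%N.
Proof.
move=> t0 XN XE.
transitivity (\sum_(1 <= d < N | (t %| d)%N) \sum_(1 <= e < E | (d * e < X.+1)%N) G d).
  rewrite (exchange_big_dep (fun d => t %| d)%N) /=; last by move=> n d _ /andP[].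
  rewrite big_nat_cond [RHS]big_nat_cond; apply: eq_bigr => d /andP[/andP[d0 _] td].
  under eq_bigl do rewrite td andbT.
  by rewrite (@sum_multiples _ E) // => ? ?.
rewrite (@sum_multiples _ N) //.
rewrite (exchange_big_dep xpredT) //=; apply: eq_big_nat => e /andP[e0 _].
have te : (0 < t * e)%N by rewrite muln_gt0 t0.
rewrite (@big_nat_widen _ _ _ 1 (X %/ (t * e)).+1 N); last first.
  by rewrite (leq_trans _ XN) // ltnS leq_div.
apply: eq_bigl => m; rewrite !ltnS leq_divRL // mulnA [(m * t)%N]mulnC.
apply/andP/idP => [[]//|tmX]; split=> //.
by rewrite (leq_ltn_trans _ XN) // (leq_trans _ tmX) // leq_pmulr.
Qed.

(** Terms with [prodset J * e > X] have an empty inner sum, so [N] and [E] may be arbitrarily large;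
    this prepares the passage to the limit. *)
Lemma sum_cyclic_subgroup_count (R : numFieldType) (k X N E : nat) :
  (0 < k)%N -> (X < N)%N -> (X < E)%N ->
  \sum_(1 <= n < X.+1) (cyclic_subgroup_count k n)%:R =
  \sum_(J : {set 'I_N} | J \subset prime_set N)
    (\prod_(p in J) local_weight R k (val p)) *
    \sum_(1 <= e < E) \sum_(1 <= m < (X %/ (prodset J * e)).+1)
       (prodset J * m)%:R ^+ k.-1 :> R.
Proof.
move=> k0 XN XE.
transitivity (\sum_(1 <= n < X.+1) \sum_(1 <= d < N | (d %| n)%N)
  \sum_(J : {set 'I_N} | (J \subset prime_set N) && (prodset J %| d)%N)
     (\prod_(p in J) local_weight R k (val p)) * d%:R ^+ k.-1).
  apply: eq_big_nat => n /andP[n0 nX].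
  rewrite (@cyclic_subgroup_countE _ _ _ N) ?n0 ?(leq_trans nX) //.
  rewrite big_nat_cond [RHS]big_nat_cond; apply: eq_bigr => d /andP[/andP[d0 _] _].
  under [X in _ * X]eq_bigr do rewrite addrC.
  rewrite prod_add_subsets mulr_sumr.
  apply: eq_big => [J|J _]; first by rewrite subset_prime_divs.
  by rewrite [X in _ * (_ * X)]big1 // mulr1 mulrC.
pose P := prime_set N.
under eq_bigr => n _.
  rewrite (exchange_big_dep (fun J : {set 'I_N} => J \subset P)) /=; last first.
    by move=> d J _ /andP[].
  over.
rewrite exchange_big /=; apply: eq_bigr => J JP.
rewrite -(@sum_divisor_multiples _ X N E _ (fun d => d%:R ^+ k.-1 : R)) //; last first.
  rewrite /prodset; apply: prodn_cond_gt0 => q /(fintype.subsetP JP).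
  by rewrite inE => /prime_gt0.
rewrite mulr_sumr; apply: eq_bigr => n _; rewrite mulr_sumr.
by apply: eq_bigl => d; rewrite JP.
Qed.

(** * Elementary estimates for sums and products *)

(** The difference of powers factors into a sum of [k] products of [k.-1] factors, each factor being
    [a] or [a + 1]. *)
Lemma exprS_diff_bounds (R : realFieldType) (k : nat) (a : R) : 0 <= a ->
  k%:R * a ^+ k.-1 <= (a + 1) ^+ k - a ^+ k <= k%:R * (a + 1) ^+ k.-1.
Proof.
move=> a0; have a1 : 0 <= a + 1 by lra.
have aa : a <= a + 1 by lra.
have kE (c : R) : k%:R * c = \sum_(i < k) c by rewrite sumr_const card_ord mulr_natl.
rewrite subrXX !kE (_ : a + 1 - a = 1) ?mul1r; last by ring.
have split_exp (i : 'I_k) (c : R) : c ^+ k.-1 = c ^+ (k.-1 - i) * c ^+ i.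
  by rewrite -exprD subnK // -ltnS (leq_trans (ltn_ord i)) // leqSpred.
apply/andP; split; apply: ler_sum => i _; rewrite (split_exp i);
  by apply: ler_pM; rewrite ?exprn_ge0 // lerXn2r ?nnegrE.
Qed.

(** Telescoping: k m^(k-1) lies between m^k - (m-1)^k and (m+1)^k - m^k. *)
Lemma sum_powers_bounds (R : realFieldType) (k q : nat) : (0 < k)%N ->
  (q%:R : R) ^+ k <= k%:R * \sum_(1 <= m < q.+1) (m%:R : R) ^+ k.-1 <=
  (q%:R + 1) ^+ k - 1.
Proof.
move=> k0; elim: q => [|q /andP[IH1 IH2]].
  by rewrite big_geq // mulr0 expr0n eqn0Ngt k0 /= add0r expr1n subrr lexx.
rewrite big_nat_recr //= mulrDr.
have /andP[lo _] := exprS_diff_bounds k (ler0n R q.+1).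
have /andP[_ hi] := exprS_diff_bounds k (ler0n R q).
rewrite -natr1 in lo *.
by apply/andP; split; lra.
Qed.

(** The error has order z^(k-1) for z >= 1 and is z^k / k for z < 1; the quantity z^k / (1 + z)
    covers both regimes. *)
Lemma sum_powers_approx (R : realFieldType) (k q : nat) (z : R) :
  (0 < k)%N -> q%:R <= z < q%:R + 1 ->
  `|\sum_(1 <= m < q.+1) m%:R ^+ k.-1 - z ^+ k / k%:R| <=
  2 ^+ k * (z ^+ k / (1 + z)).
Proof.
move=> k0 /andP[qz zq].
have z0 : 0 <= z by apply: le_trans qz.
have k1 : 1 <= k%:R :> R by rewrite ler1n.
have kp : 0 < k%:R :> R by rewrite ltr0n.
(* For [q = 0] the sum is empty and z < 1, so 1 + z < 2 <= 2^k absorbs the denominator. *)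
case: q => [|q] in qz zq *.
  rewrite big_geq // sub0r normrN ger0_norm ?divr_ge0 ?exprn_ge0 //.
  have zk : 0 <= z ^+ k by rewrite exprn_ge0.
  apply: (@le_trans _ _ (z ^+ k)); first by rewrite ler_piMr // invf_le1.
  rewrite mulrCA ler_peMr // ler_pdivlMr; last by lra.
  have : 2 ^+ 1 <= 2 ^+ k :> R by rewrite ler_eXn2l ?ltr1n.
  by rewrite expr1 mul1r; move: zq; lra.
set P := \sum_(1 <= m < _) _.
have /andP[lo hi] := sum_powers_bounds R q.+1 k0; rewrite -/P in lo hi.
have /andP[_ dif] := exprS_diff_bounds k (ler0n R q.+1).
set y := (q.+1)%:R : R in lo hi dif qz zq *.
have y1 : 1 <= y by rewrite ler1n.
have zk1 : y ^+ k <= z ^+ k by rewrite lerXn2r ?nnegrE //; lra.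
have zk2 : z ^+ k <= (y + 1) ^+ k by rewrite lerXn2r ?nnegrE //; lra.
(* Here y + 1 <= 2 z, because 1 <= y <= z. *)
have yz : (y + 1) ^+ k.-1 <= 2 ^+ k.-1 * z ^+ k.-1.
  by rewrite -exprMn lerXn2r ?nnegrE //; lra.
have kP : `|k%:R * P - z ^+ k| <= k%:R * (2 ^+ k.-1 * z ^+ k.-1).
  apply: (@le_trans _ _ (k%:R * (y + 1) ^+ k.-1)); last by rewrite ler_pM2l.
  by rewrite ler_norml; apply/andP; split; lra.
have -> : P - z ^+ k / k%:R = (k%:R * P - z ^+ k) / k%:R by field; rewrite gt_eqF.
rewrite normrM [`|k%:R^-1|]ger0_norm ?invr_ge0 ?ler0n // ler_pdivrMr //.
apply: le_trans kP _; rewrite mulrC ler_pM2r //.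
rewrite -(prednK k0) !exprS /= -mulrA mulrCA.
have c0 : 0 <= 2 ^+ k.-1 * z ^+ k.-1 by rewrite mulr_ge0 ?exprn_ge0.
(* The spare factor 2 z / (1 + z) is at least 1 since z >= 1. *)
rewrite [leRHS](_ : _ = 2 ^+ k.-1 * z ^+ k.-1 * (2 * z / (1 + z))); last first.
  by field; rewrite gt_eqF //; lra.
by rewrite ler_peMr // ler_pdivlMr; lra.
Qed.

Lemma sum_inv_exp_le2 (R : realFieldType) (j n : nat) : (2 <= j)%N ->
  \sum_(1 <= e < n) (e%:R : R) ^- j <= 2.
Proof.
move=> j2; case: n => [|[|n]]; [by rewrite big_geq|by rewrite big_geq|].
(* The strengthened bound telescopes, since (y + 1)^-2 <= 1 / y - 1 / (y + 1). *)
suff : \sum_(1 <= e < n.+2) (e%:R : R) ^- j <= 2 - n.+1%:R^-1.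
  by move=> /le_trans; apply; rewrite gerBl invr_ge0 ler0n.
elim: n => [|n IHn]; first by rewrite big_nat1 expr1n invr1; lra.
rewrite big_nat_recr //= ; set y := (n.+1)%:R : R in IHn *.
have y1 : 1 <= y by rewrite ler1n.
rewrite -natr1 -/y.
have le2 : (y + 1) ^- j <= (y + 1) ^- 2.
  by rewrite lef_pV2 ?posrE ?exprn_gt0 ?ler_eXn2l //; lra.
have step : (y + 1) ^- 2 <= y^-1 - (y + 1)^-1.
  have -> : y^-1 - (y + 1)^-1 = (y * (y + 1))^-1.
    by field; rewrite !gt_eqF //; lra.
  rewrite lef_pV2 ?posrE ?mulr_gt0 ?exprn_gt0 //; nra.
by move: IHn le2 step; clear; clearbody y; lra.
Qed.

(* The summand is at most the increment of [- ln ((m + x) / m)]. *)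
Lemma sum_weight_le_ln (R : realType) (x : R) (n : nat) : 0 < x ->
  \sum_(1 <= m < n) m%:R^-1 * (x / (x + m%:R)) <= 1 + ln (1 + x).
Proof.
move=> x0; case: n => [|[|n]].
- by rewrite big_geq // addr_ge0 ?ln_ge0 //; lra.
- by rewrite big_geq // addr_ge0 ?ln_ge0 //; lra.
have quot1 (y : R) : 0 < y -> 1 <= (y + x) / y by move=> y0; rewrite ler_pdivlMr; lra.
suff : \sum_(1 <= m < n.+2) m%:R^-1 * (x / (x + m%:R)) <=
    1 + ln (1 + x) - ln ((n.+1%:R + x) / n.+1%:R).
  by move=> /le_trans; apply; rewrite gerBl ln_ge0 // quot1 ?ltr0n.
elim: n => [|n IHn].
  rewrite big_nat1 invr1 mulr1 mul1r addrK.
  by rewrite ler_pdivrMr; lra.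
rewrite big_nat_recr //=; set y := (n.+1)%:R : R in IHn *.
have y1 : 1 <= y by rewrite ler1n.
rewrite -natr1 -/y.
pose A := (y + 1 + x) / (y + 1); pose B := (y + x) / y.
have A1 : 1 <= A by apply: quot1; lra.
have B1 : 1 <= B by apply: quot1; lra.
have lnAB : ln A - ln B <= - (x / ((y + 1) * (y + x))).
  rewrite -ln_div ?posrE; try lra.
  have -> : A / B = 1 + - (x / ((y + 1) * (y + x))).
    by rewrite /A /B; field; rewrite !gt_eqF //; lra.
  apply: le_ln1Dx.
  rewrite ltrNl opprK ltr_pdivrMr ?mulr_gt0 //; nra.
have : (y + 1)^-1 * (x / (x + (y + 1))) <= x / ((y + 1) * (y + x)).
  rewrite mulrCA -invfM ler_pM2l // lef_pV2 ?posrE ?mulr_gt0 //; nra.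
by rewrite -/A; rewrite -/B in IHn; move: IHn lnAB; clear; lra.
Qed.

(** By 1 + u <= exp u the product is controlled by a sum; each factor contributes at most [k] terms,
    none above p^-2, and the p^-2 sum to at most 2. *)
Lemma prod_prime_le_expR (R : realType) (k N : nat) :
  \prod_(0 <= p < N | prime p) (1 + \sum_(2 <= j < k) (p%:R : R) ^- j) <=
  expR (2 * k%:R).
Proof.
apply: (@le_trans _ _ (expR (\sum_(0 <= p < N | prime p) k%:R * (p%:R : R) ^- 2))).
  rewrite expR_sum; apply: ler_prod => p pp.
  have p1 : 1 <= p%:R :> R by rewrite ler1n prime_gt0.
  apply/andP; split.
    by rewrite addr_ge0 // sumr_ge0 // => j _; rewrite invr_ge0 exprn_ge0.
  apply: le_trans (expR_ge1Dx _); rewrite lerD2l big_nat_cond.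
  apply: (@le_trans _ _ (\sum_(2 <= j < k | (2 <= j < k)%N && true) (p%:R : R) ^- 2)).
    apply: ler_sum => j /andP[/andP[j2 _] _].
    by rewrite lef_pV2 ?posrE ?exprn_gt0 ?ler_weXn2l //; lra.
  rewrite -big_nat_cond sumr_const_nat -[_ *+ _]mulr_natl ler_wpM2r ?invr_ge0 ?exprn_ge0 //.
  by rewrite ler_nat leq_subr.
rewrite ler_expR -mulr_sumr mulrC ler_wpM2r //.
apply: le_trans (@sum_inv_exp_le2 R 2 N _) => //.
rewrite big_mkcond; case: N => [|N]; first by rewrite !big_geq.
rewrite big_ltn //= add0r; apply: ler_sum => p _.
by case: ifP => // _; rewrite invr_ge0 exprn_ge0.
Qed.

(** * Weighted sums over squarefree numbers *)

(** Expanding the product splits [J] into a part [S] carrying [a] and a part carrying [v]. As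
    [g J <= g S], the second part can be summed freely, and it yields the product of the
    [1 + v i]. *)
Lemma sum_subsets_antitone_le (R : numFieldType) (I : finType) (P : {set I})
    (a v : I -> R) (g : {set I} -> R) :
  (forall i, 0 <= a i) -> (forall i, 0 <= v i) -> (forall J, 0 <= g J) ->
  (forall S J : {set I}, S \subset J -> J \subset P -> g J <= g S) ->
  \sum_(J : {set I} | J \subset P) (\prod_(i in J) (a i + v i)) * g J <=
  (\prod_(i in P) (1 + v i)) *
    \sum_(S : {set I} | S \subset P) (\prod_(i in S) a i) * g S.
Proof.
move=> a0 v0 g0 ganti.
have pa0 (S : {set I}) : 0 <= \prod_(i in S) a i by rewrite prodr_ge0.
have pv0 (S : {set I}) : 0 <= \prod_(i in S) v i by rewrite prodr_ge0.
apply: (@le_trans _ _ (\sum_(J : {set I} | J \subset P) \sum_(S : {set I} | S \subset J)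
    (\prod_(i in S) a i) * g S * \prod_(i in J :\: S) v i)).
  apply: ler_sum => J JP; rewrite prod_add_subsets mulr_suml.
  by apply: ler_sum => S SJ; rewrite mulrAC ler_wpM2r // ler_wpM2l // ganti.
rewrite (exchange_big_dep (fun S : {set I} => S \subset P)) /=; last first.
  by move=> J S JP SJ; apply: fintype.subset_trans JP.
rewrite mulr_sumr; apply: ler_sum => S SP.
rewrite -mulr_sumr mulrC ler_wpM2r ?mulr_ge0 //.
under [leRHS]eq_bigr do rewrite addrC.
rewrite prod_add_subsets.
(* With [K] = [J :\: S], the sum runs over subsets of [P] disjoint from [S]; nonnegativity then
   allows all subsets of [P]. *)
rewrite (reindex_onto (fun K : {set I} => K :|: S) (fun J => J :\: S)) /=; last first.
  move=> J /andP[_ SJ]; rewrite finset.setUC finset.setDE finset.setUIr.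
  by rewrite finset.setUCr finset.setIT; apply/finset.setUidPr.
rewrite big_mkcond [leRHS]big_mkcond; apply: ler_sum => K _.
case: ifPn => [/andP[/andP[KSP _] /eqP ->]|_].
  rewrite (fintype.subset_trans (finset.subsetUl K S) KSP).
  by rewrite [X in _ * X]big1 ?mulr1.
by case: ifP => // _; rewrite [X in _ * X]big1 ?mulr1.
Qed.

Lemma prodset_inj (N : nat) :
  {in [pred J : {set 'I_N} | J \subset prime_set N] &,
    injective (@prodset N)}.
Proof.
move=> J K; rewrite !inE => JP KP JK; apply/finset.setP => p.
have primes_of (S : {set 'I_N}) : S \subset prime_set N ->
    forall q, q \in S -> prime (val q).
  by move=> /fintype.subsetP SP q /SP; rewrite inE.
have [pp|pp] := boolP (prime (val p)).
  rewrite -!prime_dvd_prodset ?JK // => q qS.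
    exact: primes_of KP _ _.
  exact: primes_of JP _ _.
by apply/idP/idP => [/(primes_of _ JP)|/(primes_of _ KP)]; rewrite (negbTE pp).
Qed.

Lemma prodset_gt0 (N : nat) (J : {set 'I_N}) :
  J \subset prime_set N -> (0 < prodset J)%N.
Proof.
move=> /fintype.subsetP JP; apply: prodn_cond_gt0 => q /JP.
by rewrite inE => /prime_gt0.
Qed.

(** By unique factorization distinct sets of primes have distinct products, so the left side is a
    partial sum of the right side as soon as [M] exceeds every product. *)
Lemma sum_prodset_le (R : numFieldType) (N : nat) (G : nat -> R) :
  (forall m, 0 <= G m) ->
  exists M, \sum_(J : {set 'I_N} | J \subset prime_set N)
     G (prodset J) <= \sum_(1 <= m < M) G m.
Proof.
move=> G0; set P := [set p : 'I_N | _].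
pose M := (\max_(J : {set 'I_N}) prodset J).+1; exists M.
have -> : \sum_(J : {set 'I_N} | J \subset P) G (prodset J) =
    \sum_(J : {set 'I_N} | J \subset P) \sum_(1 <= m < M | m == prodset J) G m.
  apply: eq_bigr => J JP; rewrite big_mkcond (bigD1_seq (prodset J)) ?iota_uniq //=.
    by rewrite eqxx big1 ?addr0 // => m mJ; rewrite (negbTE mJ).
  by rewrite mem_index_iota prodset_gt0 // ltnS leq_bigmax.
rewrite (exchange_big_dep xpredT) //=; apply: ler_sum => m _.
have [J0 /andP[J0P /eqP mJ0]|none] :=
  pickP (fun J : {set 'I_N} => (J \subset P) && (m == prodset J)).
  rewrite (big_pred1 J0) // => J; apply/idP/eqP => [/andP[JP /eqP mJ]|->].
    by apply: prodset_inj; rewrite ?inE // -mJ.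
  by rewrite J0P mJ0 eqxx.
by rewrite big_pred0.
Qed.

Lemma prodset_le (N : nat) (S J : {set 'I_N}) :
  S \subset J -> J \subset prime_set N ->
  (prodset S <= prodset J)%N.
Proof.
move=> SJ JP; rewrite dvdn_leq ?prodset_gt0 // /prodset.
by rewrite [X in (_ %| X)%N](big_setID S) /= (finset.setIidPr SJ) dvdn_mulr.
Qed.

Lemma natr_prodset (R : fieldType) (N : nat) (J : {set 'I_N}) :
  \prod_(p in J) ((val p)%:R^-1 : R) = (prodset J)%:R^-1.
Proof. by rewrite /prodset natr_prod prodfV. Qed.

Lemma local_weight_split (R : numFieldType) (k p : nat) : (1 < k)%N ->
  local_weight R k p = p%:R^-1 + \sum_(2 <= j < k) (p%:R : R) ^- j.
Proof. by move=> k1; rewrite /local_weight big_ltn // expr1. Qed.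

Lemma sum_prodset_weight_le (R : realType) (k N : nat) (x : R) :
  (1 < k)%N -> 0 < x ->
  \sum_(J : {set 'I_N} | J \subset prime_set N)
    (\prod_(p in J) local_weight R k (val p)) * (x / (x + (prodset J)%:R)) <=
  expR (2 * k%:R) * (1 + ln (1 + x)).
Proof.
move=> k1 x0.
under eq_bigr do under eq_bigr do rewrite local_weight_split //.
have xm0 (m : nat) : 0 <= x / (x + m%:R) by rewrite divr_ge0 ?addr_ge0 //; lra.
apply: le_trans.
  (* Here [a] is p^-1, [v] is the tail from p^-2 on, and [g] is x / (x + t), which decreases as the
     product t grows with the set. *)
  apply: sum_subsets_antitone_le => [i|i|J|S J SJ JP].
  - by rewrite invr_ge0.
  - by rewrite sumr_ge0 // => j _; rewrite invr_ge0 exprn_ge0.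
  - exact: xm0.
  - rewrite ler_pM2l // lef_pV2 ?posrE ?ltr_wpDr // lerD2l ler_nat.
    exact: prodset_le.
apply: ler_pM.
- by rewrite prodr_ge0 // => i _; rewrite addr_ge0 // sumr_ge0.
- by rewrite sumr_ge0 // => S _; rewrite mulr_ge0 // prodr_ge0.
- apply: le_trans (prod_prime_le_expR R k N).
  by rewrite big_mkord; under eq_bigl do rewrite inE.
under eq_bigr do rewrite natr_prodset.
have [|M le1] := @sum_prodset_le R N (fun m => m%:R^-1 * (x / (x + m%:R))).
  by move=> m; rewrite mulr_ge0 ?invr_ge0.
by apply: (le_trans le1); exact: sum_weight_le_ln.
Qed.

(** * The asymptotic formula with truncated product and series *)

(** Since p^-2 + ... + p^-k is the local weight divided by p, the truncated product for H(k) expands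
    into the coefficients of the main term. *)
Lemma prod_primes_sum_subsets (R : numFieldType) (k N : nat) :
  \prod_(0 <= p < N | prime p) (1 + \sum_(2 <= j < k.+1) (p%:R : R) ^- j) =
  \sum_(J : {set 'I_N} | J \subset prime_set N)
    (\prod_(p in J) local_weight R k (val p)) / (prodset J)%:R.
Proof.
rewrite big_mkord.
transitivity (\prod_(p in prime_set N)
    (local_weight R k (val p) * (val p)%:R^-1 + 1)).
  apply: eq_big => [p|p _]; first by rewrite inE.
  rewrite addrC big_add1 /= /local_weight mulr_suml; congr (_ + _).
  by apply: eq_bigr => j _; rewrite exprSr invfM.
rewrite prod_add_subsets; apply: eq_bigr => J _.
by rewrite [X in _ * X]big1 // mulr1 big_split /= natr_prodset.
Qed.

(** The estimate for sums of powers is applied at z = x / (t e), whose integer part is the upper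
    limit of the sum, and scaled by t^(k-1). *)
Lemma sum_multiple_powers_approx (R : archiRealFieldType) (k t e : nat) (x : R) :
  (0 < k)%N -> (0 < t)%N -> (0 < e)%N -> 0 <= x ->
  `|\sum_(1 <= m < (Num.truncn x %/ (t * e)).+1) (t * m)%:R ^+ k.-1 -
    x ^+ k / k%:R * t%:R^-1 * e%:R ^- k| <=
  2 ^+ k * x ^+ k.-1 * (x / (x + t%:R)) * e%:R ^- k.-1.
Proof.
move=> k0 t0 e0 x0; set q := (_ %/ _)%N.
have tp : 0 < t%:R :> R by rewrite ltr0n.
have ep : 1 <= e%:R :> R by rewrite ler1n.
have /andP[xX xX1] := Num.Theory.truncn_itv x0.
pose z : R := x / (t%:R * e%:R).
have te0 : 0 < t%:R * e%:R :> R by rewrite mulr_gt0 //; lra.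
have qz : q%:R <= z < q%:R + 1.
  rewrite /z ler_pdivlMr // ltr_pdivrMr // natr1 -natrM -!natrM.
  apply/andP; split.
    by apply: le_trans xX; rewrite ler_nat /q leq_trunc_div.
  by apply: lt_le_trans xX1 _; rewrite ler_nat /q ltn_ceil // muln_gt0 t0.
have z0 : 0 <= z by rewrite divr_ge0 // ltW.
have E0 : e%:R != 0 :> R by rewrite pnatr_eq0 -lt0n.
have T0 : t%:R != 0 :> R by rewrite pnatr_eq0 -lt0n.
have ej0 : e%:R ^+ k.-1 != 0 :> R by rewrite expf_neq0.
have tj0 : t%:R ^+ k.-1 != 0 :> R by rewrite expf_neq0.
have -> : \sum_(1 <= m < q.+1) (t * m)%:R ^+ k.-1 - x ^+ k / k%:R * t%:R^-1 * e%:R ^- k =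
   t%:R ^+ k.-1 * (\sum_(1 <= m < q.+1) m%:R ^+ k.-1 - z ^+ k / k%:R).
  rewrite mulrBr mulr_sumr; congr (_ - _).
    by apply: eq_bigr => m _; rewrite natrM exprMn.
  rewrite /z -(prednK k0) /= !expr_div_n !exprMn !exprSr.
  by field; rewrite ej0 tj0 T0 E0 addrC natr1 pnatr_eq0.
rewrite normrM ger0_norm ?exprn_ge0 //.
apply: (@le_trans _ _ (t%:R ^+ k.-1 * (2 ^+ k * (z ^+ k / (1 + z))))).
  by rewrite ler_wpM2l ?exprn_ge0 // sum_powers_approx.
have -> : t%:R ^+ k.-1 * (2 ^+ k * (z ^+ k / (1 + z))) =
    2 ^+ k * x ^+ k.-1 * (x / (x + t%:R * e%:R)) * e%:R ^- k.-1.
  rewrite /z -(prednK k0) /= !expr_div_n !exprMn !exprSr.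
  by field; rewrite ej0 tj0 E0 T0 gt_eqF ?ltr_wpDl.
(* As e >= 1, the denominator x + t e is bounded below by x + t, which frees the factor x / (x + t)
   from e. *)
rewrite ler_wpM2r ?invr_ge0 ?exprn_ge0 // ler_wpM2l ?mulr_ge0 ?exprn_ge0 // ler_wpM2l //.
by rewrite lef_pV2 ?posrE ?ltr_wpDl // lerD2l ler_peMr // ltW.
Qed.

(** The bound is free of [N] and [E], which allows both to tend to infinity while [x] stays
    fixed. *)
Lemma sum_cyclic_subgroup_count_approx (R : realType) (k N E : nat) (x : R) :
  (3 <= k)%N -> 0 < x -> (Num.truncn x < N)%N -> (Num.truncn x < E)%N ->
  `|\sum_(1 <= n < (Num.truncn x).+1) (cyclic_subgroup_count k n)%:R -
    x ^+ k / k%:R *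
    (\prod_(0 <= p < N | prime p) (1 + \sum_(2 <= j < k.+1) (p%:R : R) ^- j)) *
    \sum_(1 <= e < E) e%:R ^- k| <=
  2 ^+ k * x ^+ k.-1 * 2 * (expR (2 * k%:R) * (1 + ln (1 + x))).
Proof.
move=> k3 x0 XN XE; have k0 : (0 < k)%N by apply: leq_trans k3.
have k1 : (1 < k)%N by apply: leq_trans k3.
rewrite (sum_cyclic_subgroup_count _ k0 XN XE) prod_primes_sum_subsets.
rewrite [X in X * _]mulr_sumr mulr_suml -sumrB.
pose h (J : {set 'I_N}) := \prod_(p in J) local_weight R k (val p).
have h0 (J : {set 'I_N}) : 0 <= h J.
  by rewrite prodr_ge0 // => p _; rewrite sumr_ge0.
apply: le_trans (ler_norm_sum _ _ _) _.
apply: (@le_trans _ _ (\sum_(J : {set 'I_N} | J \subset prime_set N)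
    2 ^+ k * x ^+ k.-1 * 2 * (h J * (x / (x + (prodset J)%:R))))); last first.
  rewrite -mulr_sumr ler_wpM2l ?mulr_ge0 ?exprn_ge0 ?(ltW x0) //.
  exact: sum_prodset_weight_le.
apply: ler_sum => J JP; rewrite -/(h J).
have t0 := prodset_gt0 JP.
have -> : x ^+ k / k%:R * (h J / (prodset J)%:R) * (\sum_(1 <= e < E) e%:R ^- k) =
    h J * \sum_(1 <= e < E) x ^+ k / k%:R * (prodset J)%:R^-1 * e%:R ^- k.
  by rewrite -mulr_sumr; ring.
rewrite -mulrBr -sumrB normrM ger0_norm //.
set c := 2 ^+ k * x ^+ k.-1 * (x / (x + (prodset J)%:R)).
have c0 : 0 <= c by rewrite !mulr_ge0 ?invr_ge0 ?addr_ge0 ?exprn_ge0 ?(ltW x0).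
have -> : 2 ^+ k * x ^+ k.-1 * 2 * (h J * (x / (x + (prodset J)%:R))) = h J * (c * 2).
  by rewrite /c; ring.
rewrite ler_wpM2l //.
(* The full strength of [3 <= k] enters here: the exponent [k.-1] is at least 2, so the sum over e
   is at most 2. *)
apply: (@le_trans _ _ (\sum_(1 <= e < E) c * e%:R ^- k.-1)); last first.
  by rewrite -mulr_sumr ler_wpM2l // sum_inv_exp_le2 // -ltnS prednK.
apply: le_trans (ler_norm_sum _ _ _) _.
rewrite big_nat_cond [leRHS]big_nat_cond; apply: ler_sum => e /andP[/andP[e0 _] _].
by apply: sum_multiple_powers_approx; rewrite ?(ltW x0).
Qed.

(** * Passage to the limit and the O-estimate *)

Lemma series_riemannRE (R : realType) (k n : nat) :
  series (riemannR (k%:R : R)) n = \sum_(1 <= e < n.+1) (e%:R : R) ^- k.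
Proof.
rewrite /series /= big_add1 /=; apply: eq_bigr => i _.
by rewrite /riemannR powR_mulrn.
Qed.

Lemma is_cvg_series_riemannR (R : realType) (k : nat) : (2 <= k)%N ->
  cvgn (series (riemannR (k%:R : R))).
Proof.
move=> k2; apply: nondecreasing_is_cvgn.
  by apply: nondecreasing_series => n _ _; rewrite ltW // riemannR_gt0.
exists 2 => _ [n _ <-]; rewrite series_riemannRE.
exact: sum_inv_exp_le2.
Qed.

Lemma is_cvg_H_product (R : realType) (k : nat) :
  cvgn (fun N : nat => \prod_(0 <= p < N | prime p)
     (1 + \sum_(2 <= j < k.+1) (p%:R : R) ^- j)).
Proof.
have ge1 (p : nat) : 1 <= 1 + \sum_(2 <= j < k.+1) (p%:R : R) ^- j.
  by rewrite lerDl sumr_ge0 // => j _; rewrite invr_ge0 exprn_ge0.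
apply: nondecreasing_is_cvgn; last first.
  by exists (expR (2 * k.+1%:R)) => _ [n _ <-]; exact: prod_prime_le_expR.
apply/nondecreasing_seqP => n; rewrite big_mkcond [leRHS]big_mkcond big_nat_recr //=.
rewrite ler_peMr //; last by case: ifP.
by rewrite prodr_ge0 // => p _; case: ifP => // _; rewrite (le_trans ler01).
Qed.

Lemma cyclic_subgroup_count_asymptotic (R : realType) (k : nat) (x : R) :
  (3 <= k)%N -> 0 < x ->
  `|\sum_(1 <= n < (Num.truncn x).+1) (cyclic_subgroup_count k n)%:R -
    riemann_zeta (k%:R : R) / k%:R * H_product R k * x ^+ k| <=
  2 ^+ k * x ^+ k.-1 * 2 * (expR (2 * k%:R) * (1 + ln (1 + x))).
Proof.
move=> k3 x0; set S := \sum_(1 <= n < _) _.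
pose H_ (N : nat) : R :=
  \prod_(0 <= p < N | prime p) (1 + \sum_(2 <= j < k.+1) (p%:R : R) ^- j).
have cvgS : ((fun N => `|S - x ^+ k / k%:R * H_ N * series (riemannR (k%:R : R)) N|)
   @ \oo --> `|S - x ^+ k / k%:R * H_product R k * riemann_zeta (k%:R : R)|)%classic.
  apply: cvg_norm; apply: cvgB; first exact: cvg_cst.
  apply: cvgM; last by apply: is_cvg_series_riemannR; apply: leq_trans k3.
  by apply: cvgM; [exact: cvg_cst|exact: is_cvg_H_product].
rewrite (_ : _ * x ^+ k =
  x ^+ k / k%:R * H_product R k * riemann_zeta (k%:R : R)); last by ring.
apply: (cvgr_to_le cvgS).
near=> N; rewrite series_riemannRE.
have XN : (Num.truncn x < N)%N by near: N; exact: nbhs_infty_gt.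
(* The [N]-th partial sum of the series ends at e = N, so the truncation is used with [E = N.+1]. *)
exact: sum_cyclic_subgroup_count_approx k3 x0 XN (leqW XN).
Unshelve. all: by end_near.
Qed.

Theorem proposition1 (R : realType) (k : nat) (k_ge3 : (3 <= k)%N) :
  (fun x : R =>
     \sum_(1 <= n < (Num.truncn x).+1) ((cyclic_subgroup_count k n)%:R : R))
  = (fun x : R =>
       riemann_zeta (k%:R : R) / k%:R * H_product R k * x ^+ k)
    +O_+oo (fun x : R => x ^+ k.-1 * ln x).
Proof.
apply/eqaddOP.
(* The factor 3 comes from 1 + ln (1 + x) <= 3 ln x for large x; the others are those of the bound
   at fixed x. *)
pose C : R := 2 ^+ k * 2 * expR (2 * k%:R) * 3.
near=> c; near=> x.
have x2 : 2 <= x by near: x; apply: nbhs_pinfty_ge; rewrite num_real.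
have xe : expR 1 <= x by near: x; apply: nbhs_pinfty_ge; rewrite num_real.
have Cc : C <= c by near: c; apply: nbhs_pinfty_ge; rewrite num_real.
have x0 : 0 < x by lra.
have lnx1 : 1 <= ln x by rewrite -[leLHS](@expRK R) ler_ln ?posrE ?expR_gt0.
(* This is 1 + x <= x^2, valid for x >= 2. *)
have ln1x : ln (1 + x) <= 2 * ln x.
  have -> : 2 * ln x = ln (x * x) by rewrite lnM ?posrE //; ring.
  by rewrite ler_ln ?posrE ?mulr_gt0 //; nra.
have xk0 : 0 <= x ^+ k.-1 by rewrite exprn_ge0 // ltW.
have ln0 : 0 <= x ^+ k.-1 * ln x by rewrite mulr_ge0 //; lra.
rewrite [`|_ * ln x|]ger0_norm //.
apply: le_trans (cyclic_subgroup_count_asymptotic k_ge3 x0) _.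
apply: (@le_trans _ _ (C * (x ^+ k.-1 * ln x))); last by rewrite ler_wpM2r.
have -> : C * (x ^+ k.-1 * ln x) =
    2 ^+ k * x ^+ k.-1 * 2 * (expR (2 * k%:R) * (3 * ln x)) by rewrite /C; ring.
rewrite ler_wpM2l ?mulr_ge0 ?exprn_ge0 // ler_wpM2l ?expR_ge0 //.
by lra.
Unshelve. all: by end_near.
Qed.
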